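(* Let $n\ge2$ and let $S_N.o\cong S_N$ be the Lie hypersurface of $G_2^\ast(\mathbb{R}^{n+3})$ described below, with its induced Riemannian metric. Then this metric is a nontrivial (non-Einstein) solvsoliton; in particular it is a nongradient expanding Ricci soliton.
   Context: Identify $G_2^\ast(\mathbb{R}^{n+3})=\mathrm{SO}_0(2,n+1)/(\mathrm{SO}(2)\times\mathrm{SO}(n+1))$, with invariant metric normalized to minimal sectional curvature $-8$, with the simply-connected Lie group $S$ whose Lie algebra $\mathfrak{s}$ has orthonormal basis $A_1,A_2,X_0,Y_1,\dots,Y_{n-1},Z_1,\dots,Z_{n-1},W_0$ and nonzero brackets (with $c=2\sqrt2$) $[A_1,X_0]=cX_0$, $[A_1,Y_i]=-(c/2)Y_i$, $[A_1,Z_i]=(c/2)Z_i$, $[A_2,Y_i]=(c/2)Y_i$, $[A_2,Z_i]=(c/2)Z_i$, $[A_2,W_0]=cW_0$, $[X_0,Y_i]=cZ_i$, $[Y_i,Z_i]=cW_0$, with the left-invariant metric making the basis orthonormal. Let $N=\frac1{\sqrt2}(-A_1-A_2)$, $\mathfrak{s}_N=\mathfrak{s}\ominus\mathbb{R}N$, $S_N$ the connected subgroup with Lie algebra $\mathfrak{s}_N$, and $S_N.o$ its orbit through the identity. A metric Lie algebra is an algebraic Ricci soliton with constant $c$ if $\mathrm{Ric}=cI+D$ for a derivation $D$; a solvsoliton is one on a solvable Lie algebra; nontrivial means not Einstein. A Ricci soliton metric satisfies $\mathrm{Ric}_g=cg+\mathcal{L}_Xg$; expanding means $c<0$; gradient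 means $X$ can be chosen as a gradient field. *)

(* Defs.v *)
From Stdlib Require Import Reals Lra.
Open Scope R_scope.

(** Vectors of R^m are represented as functions nat -> R (only the
    coordinates < m are meaningful; our constructions keep the others 0). *)
Definition vec := nat -> R.

Fixpoint rsum (k : nat) (g : nat -> R) : R :=
  match k with O => 0 | S k' => rsum k' g + g k' end.

Definition vzero : vec := fun _ => 0.
Definition vadd (x y : vec) : vec := fun i => x i + y i.
Definition vscal (a : R) (x : vec) : vec := fun i => a * x i.
Definition vsum (k : nat) (g : nat -> vec) : vec := fun i => rsum k (fun l => g l i).
Definition unitv (k : nat) : vec := fun i => if Nat.eqb i k then 1 else 0.
Definition veq (x y : vec) : Prop := forall i, x i = y i.

Definition ip (m : nat) (x y : vec) : R := rsum m (fun i => x i * y i).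

(** ------------------------------------------------------------------
    The solvable Lie algebra s of G_2^*(R^{n+3}), dimension m = 2n+2.
    Index layout of the orthonormal basis:
      0 = A1, 1 = A2, 2 = X0,
      2+j   = Y_j   (1 <= j <= n-1),  i.e. indices 3 .. n+1
      n+1+j = Z_j   (1 <= j <= n-1),  i.e. indices n+2 .. 2n
      2n+1  = W0.
    c = 2 sqrt 2.                                                        *)
Definition cc : R := 2 * sqrt 2.
Definition sdim (n : nat) : nat := 2 * n + 2.

Definition isY (n j : nat) : bool := Nat.leb 3 j && Nat.leb j (n + 1).
Definition isZ (n j : nat) : bool := Nat.leb (n + 2) j && Nat.leb j (2 * n).

Definition br_lt (n i j : nat) : vec :=
  if Nat.eqb i 0 then
    (if Nat.eqb j 2 then vscal cc (unitv 2)
     else if isY n j then vscal (- (cc / 2)) (unitv j)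
     else if isZ n j then vscal (cc / 2) (unitv j)
     else vzero)
  else if Nat.eqb i 1 then
    (if isY n j then vscal (cc / 2) (unitv j)
     else if isZ n j then vscal (cc / 2) (unitv j)
     else if Nat.eqb j (2 * n + 1) then vscal cc (unitv j)
     else vzero)
  else if Nat.eqb i 2 then
    (if isY n j then vscal cc (unitv (j + (n - 1))) else vzero)
  else if isY n i then
    (if Nat.eqb j (i + (n - 1)) then vscal cc (unitv (2 * n + 1)) else vzero)
  else vzero.

Definition br_basis (n i j : nat) : vec :=
  if Nat.ltb i j then br_lt n i j
  else if Nat.ltb j i then vscal (-1) (br_lt n j i)
  else vzero.

Definition sbr (n : nat) (x y : vec) : vec :=
  vsum (sdim n) (fun i => vsum (sdim n) (fun j => vscal (x i * y j) (br_basis n i j))).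

Definition Nvec : vec :=
  fun i => if Nat.eqb i 0 then - (1 / sqrt 2)
           else if Nat.eqb i 1 then - (1 / sqrt 2) else 0.

(** f_0 .. f_{2n} is an orthonormal basis of s_N = s ⊖ R N
    (vectors of R^{2n+2}, orthonormal, orthogonal to N; 2n+1 of them,
    hence spanning the orthogonal complement of N). *)
Definition ONB_sN (n : nat) (f : nat -> vec) : Prop :=
  (forall l i, (l < 2 * n + 1)%nat -> (sdim n <= i)%nat -> f l i = 0) /\
  (forall a b, (a < 2 * n + 1)%nat -> (b < 2 * n + 1)%nat ->
       ip (sdim n) (f a) (f b) = if Nat.eqb a b then 1 else 0) /\
  (forall l, (l < 2 * n + 1)%nat -> ip (sdim n) (f l) Nvec = 0).

(** ------------------------------------------------------------------
    Generic notions for a metric Lie algebra (V, br, <,>) where V is the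
    span of an orthonormal family f_0..f_{k-1} in (vec, ip) and br is a
    bracket with [V,V] ⊆ V.  Its Riemannian geometry is that of the
    corresponding left-invariant metric on the simply connected Lie group. *)
Section MetricLie.
Variable (br : vec -> vec -> vec) (ipr : vec -> vec -> R) (f : nat -> vec) (k : nat).

Definition inV (x : vec) : Prop :=
  exists a : nat -> R, veq x (vsum k (fun l => vscal (a l) (f l))).

(** Levi-Civita connection on left-invariant fields (Koszul formula):
    2<nabla_X Y, Z> = <[X,Y],Z> - <[Y,Z],X> + <[Z,X],Y>. *)
Definition lc (X Y : vec) : vec :=
  vsum k (fun l => vscal ((1/2) * (ipr (br X Y) (f l) - ipr (br Y (f l)) X
                                   + ipr (br (f l) X) Y)) (f l)).

Definition curv (X Y Z : vec) : vec :=
  vadd (vadd (lc X (lc Y Z)) (vscal (-1) (lc Y (lc X Z)))) (vscal (-1) (lc (br X Y) Z)).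

Definition ric (X Y : vec) : R := rsum k (fun l => ipr (curv (f l) X Y) (f l)).

Definition ric_op (X : vec) : vec := vsum k (fun l => vscal (ric X (f l)) (f l)).

Definition is_derivation (D : vec -> vec) : Prop :=
  (forall x, inV x -> inV (D x)) /\
  (forall a b x y, inV x -> inV y -> veq (D (vadd (vscal a x) (vscal b y)))
                                      (vadd (vscal a (D x)) (vscal b (D y)))) /\
  (forall x y, inV x -> inV y ->
      veq (D (br x y)) (vadd (br (D x) y) (br x (D y)))).

Definition alg_ricci_soliton (c : R) : Prop :=
  exists D : vec -> vec, is_derivation D /\
     forall x, inV x -> veq (ric_op x) (vadd (vscal c x) (D x)).

Definition einstein : Prop :=
  exists c : R, forall x, inV x -> veq (ric_op x) (vscal c x).

Inductive derived (P : vec -> Prop) : vec -> Prop :=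
| der_br : forall x y, P x -> P y -> derived P (br x y)
| der_zero : derived P vzero
| der_add : forall x y, derived P x -> derived P y -> derived P (vadd x y)
| der_scal : forall a x, derived P x -> derived P (vscal a x)
| der_ext : forall x y, veq x y -> derived P x -> derived P y.

Fixpoint derser (j : nat) : vec -> Prop :=
  match j with O => inV | S j' => derived (derser j') end.

Definition solvable : Prop :=
  exists j, forall x, derser j x -> veq x vzero.

Definition nontrivial_solvsoliton_with_const (c : R) : Prop :=
  solvable /\ alg_ricci_soliton c /\ ~ einstein.

End MetricLie.

(* Main.v *)
Require Import Defs.
From Stdlib Require Import Reals Lra Lia FunctionalExtensionality.
From mathcomp Require ssreflect ssrfun ssrbool eqtype ssrnat fintype bigop ssralg matrix Rstruct.
Open Scope R_scope.

(* In the orthonormal basis H = (A1 - A2)/sqrt 2, X0, Y_i, Z_i, W0 of s_N the only nonzero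
   brackets are [H, X0] = 2 X0, [H, Y_i] = -2 Y_i, [H, W0] = -2 W0, [X0, Y_i] = 2 sqrt 2 Z_i and
   [Y_i, Z_i] = 2 sqrt 2 W0.  Solving the Koszul formula gives the Levi-Civita connection in
   closed form, and tracing the curvature gives Ric = -(4n+4) Id + D, where D is 4n+4 times the
   projection onto span(X0, Z_i, W0).  D is a derivation because it is the grading with weight 0
   on H, Y_i and weight 1 on X0, Z_i, W0; Ric is not a multiple of the identity because
   Ric X0 = 0 while Ric Y_1 = -(4n+4) Y_1; and s_N is solvable with derived series
   s_N > span(X0, Y_i, Z_i, W0) > span(Z_i, W0) > 0.
   The metric notions are defined through an arbitrary orthonormal basis f of s_N inside R^(2n+2),
   so everything is computed in the coordinate model above and transported along its isometric
   embedding; the Ricci trace does not see the choice of f because f satisfies Parseval's identity. *)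

Lemma rsum_ext k g h : (forall i, (i < k)%nat -> g i = h i) -> rsum k g = rsum k h.
Proof.
induction k as [|k IH]; intros E; simpl; [reflexivity|].
rewrite IH by (intros; apply E; lia). rewrite E by lia. reflexivity.
Qed.

Lemma rsum_add k g h : rsum k (fun i => g i + h i) = rsum k g + rsum k h.
Proof. induction k; simpl; [ring|rewrite IHk; ring]. Qed.

Lemma rsum_sub k g h : rsum k (fun i => g i - h i) = rsum k g - rsum k h.
Proof. induction k; simpl; [ring|rewrite IHk; ring]. Qed.

Lemma rsum_scal_l k a g : rsum k (fun i => a * g i) = a * rsum k g.
Proof. induction k; simpl; [ring|rewrite IHk; ring]. Qed.

Lemma rsum_scal_r k a g : rsum k (fun i => g i * a) = rsum k g * a.
Proof. induction k; simpl; [ring|rewrite IHk; ring]. Qed.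

Lemma rsum_eq0 k g : (forall i, (i < k)%nat -> g i = 0) -> rsum k g = 0.
Proof.
intros E. transitivity (rsum k (fun _ => 0)); [now apply rsum_ext|].
clear E. induction k; simpl; [|rewrite IHk]; ring.
Qed.

Lemma rsum_const k a : rsum k (fun _ => a) = INR k * a.
Proof. induction k; simpl rsum; [simpl; ring|rewrite IHk, S_INR; ring]. Qed.

Lemma rsum_split p q g : rsum (p + q) g = rsum p g + rsum q (fun i => g (p + i)%nat).
Proof.
induction q as [|q IH]; simpl; [rewrite Nat.add_0_r; ring|].
rewrite Nat.add_succ_r. simpl. rewrite IH. ring.
Qed.

Lemma rsum_swap p q g :
  rsum p (fun i => rsum q (fun j => g i j)) = rsum q (fun j => rsum p (fun i => g i j)).
Proof.
induction p; simpl; [symmetry; now apply rsum_eq0|].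
rewrite IHp, <- rsum_add. reflexivity.
Qed.

Lemma sqrt2_sq : sqrt 2 ^ 2 = 2.
Proof. rewrite <- Rsqr_pow2. apply Rsqr_sqrt. lra. Qed.

Ltac field_sqrt2 := field_simplify; [rewrite sqrt2_sq; field | exact sqrt2_neq_0].

Lemma unitv_diag i : unitv i i = 1.
Proof. unfold unitv. now rewrite Nat.eqb_refl. Qed.

Lemma unitv_sym i j : unitv i j = unitv j i.
Proof. unfold unitv. now rewrite Nat.eqb_sym. Qed.

Lemma rsum_unitv_l k p g : rsum k (fun i => unitv p i * g i) = if Nat.ltb p k then g p else 0.
Proof.
induction k; simpl; [reflexivity|]. rewrite IHk. unfold unitv.
destruct (Nat.ltb_spec p k), (Nat.ltb_spec p (S k)), (Nat.eqb_spec k p); try lia; subst; ring.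
Qed.

Lemma rsum_unitv_r k p g : rsum k (fun i => g i * unitv p i) = if Nat.ltb p k then g p else 0.
Proof. rewrite <- rsum_unitv_l. apply rsum_ext; intros; ring. Qed.

Ltac nat_cases := repeat (match goal with
  | |- context [Nat.eqb ?x ?y] => let E := fresh in destruct (Nat.eqb_spec x y) as [E|E]; [try subst x|]
  | |- context [Nat.leb ?x ?y] => destruct (Nat.leb_spec x y)
  | |- context [Nat.ltb ?x ?y] => destruct (Nat.ltb_spec x y)
  end; cbn [andb orb] in *; try (exfalso; lia)).

Ltac destruct_ifs := repeat match goal with |- context [if ?b then _ else _] => destruct b end.

Lemma rsum_unitv_shift k p q g : rsum k (fun i => unitv p (q + i)%nat * g i) =
  if andb (q <=? p) (p <? q + k)%nat then g (p - q)%nat else 0.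
Proof.
induction k as [|k IH]; simpl; [nat_cases; reflexivity|].
rewrite IH. unfold unitv. nat_cases; try ring.
replace (p - q)%nat with k by lia; ring.
Qed.

Module OrthonormalColumns.
Import ssreflect ssrfun ssrbool eqtype ssrnat fintype bigop ssralg matrix Rstruct GRing.Theory.
Local Open Scope ring_scope.

Lemma rsum_big k g : rsum k g = \sum_(i < k) g i.
Proof. elim: k => [|k IH] /=; [by rewrite big_ord0 | by rewrite big_ord_recr /= IH]. Qed.

Lemma kronecker_ord {S} (i j : 'I_S) : (if Nat.eqb i j then R1 else R0) = (i == j)%:R.
Proof.
case: (Nat.eqb_spec i j) => e; first by rewrite (val_inj e) eqxx.
by rewrite (introF eqP) // => ij; apply: e; rewrite ij.
Qed.

(* For square [M], [M M^T = 1] forces [M^T M = 1]. *)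
Lemma orthonormal_cols (S : nat) (F : nat -> nat -> R) :
  (forall a b, (a < S)%coq_nat -> (b < S)%coq_nat ->
     rsum S (fun i => Rmult (F a i) (F b i)) = if Nat.eqb a b then R1 else R0) ->
  forall i j, (i < S)%coq_nat -> (j < S)%coq_nat ->
     rsum S (fun a => Rmult (F a i) (F a j)) = if Nat.eqb i j then R1 else R0.
Proof.
move=> rows i j /ltP hi /ltP hj.
pose M : 'M[R]_S := \matrix_(a < S, b < S) F a b.
have MMt : M *m M^T = 1%:M.
  apply/matrixP => a b; rewrite !mxE -kronecker_ord -rows ?rsum_big; try exact/ltP.
  by apply: eq_bigr => k _; rewrite !mxE.
have /matrixP /(_ (Ordinal hi) (Ordinal hj)) := mulmx1C MMt.
rewrite !mxE -(kronecker_ord (Ordinal hi) (Ordinal hj)) /= rsum_big => <-.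
by apply: eq_bigr => k _; rewrite !mxE.
Qed.
End OrthonormalColumns.

Section InnerProduct.
Variable m : nat.

Lemma ip_comm x y : ip m x y = ip m y x.
Proof. apply rsum_ext; intros; ring. Qed.
Lemma ip_add_l g h x : ip m (fun i => g i + h i) x = ip m g x + ip m h x.
Proof. unfold ip. rewrite <- rsum_add. apply rsum_ext; intros; ring. Qed.
Lemma ip_add_r g h x : ip m x (fun i => g i + h i) = ip m x g + ip m x h.
Proof. unfold ip. rewrite <- rsum_add. apply rsum_ext; intros; ring. Qed.
Lemma ip_sub_l g h x : ip m (fun i => g i - h i) x = ip m g x - ip m h x.
Proof. unfold ip. rewrite <- rsum_sub. apply rsum_ext; intros; ring. Qed.
Lemma ip_sub_r g h x : ip m x (fun i => g i - h i) = ip m x g - ip m x h.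
Proof. unfold ip. rewrite <- rsum_sub. apply rsum_ext; intros; ring. Qed.
Lemma ip_scal_l t g x : ip m (fun i => t * g i) x = t * ip m g x.
Proof. unfold ip. rewrite <- rsum_scal_l. apply rsum_ext; intros; ring. Qed.
Lemma ip_scal_r t g x : ip m x (fun i => t * g i) = t * ip m x g.
Proof. unfold ip. rewrite <- rsum_scal_l. apply rsum_ext; intros; ring. Qed.
Lemma ip_0_l x : ip m (fun _ => 0) x = 0.
Proof. apply rsum_eq0; intros; ring. Qed.
Lemma ip_0_r x : ip m x (fun _ => 0) = 0.
Proof. apply rsum_eq0; intros; ring. Qed.
Lemma ip_unitv_l i x : (i < m)%nat -> ip m (unitv i) x = x i.
Proof. intros. unfold ip. rewrite rsum_unitv_l. destruct (Nat.ltb_spec i m); [reflexivity|lia]. Qed.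
Lemma ip_unitv_r i x : (i < m)%nat -> ip m x (unitv i) = x i.
Proof. intros. rewrite ip_comm. now apply ip_unitv_l. Qed.

End InnerProduct.

Ltac ip_simpl := repeat rewrite ?ip_add_l, ?ip_add_r, ?ip_sub_l, ?ip_sub_r,
  ?ip_scal_l, ?ip_scal_r, ?ip_0_l, ?ip_0_r.

(** * The coordinate model of s_N *)

(* Coordinates in the basis H, X0, Y_(i+1), Z_(i+1), W0 (i < m, where m = n - 1) of s_N;
   the entries [cY i], [cZ i] with [m <= i] are junk. *)
Record sNvec := SNvec { cH : R; cX : R; cY : nat -> R; cZ : nat -> R; cW : R }.

Lemma sNvec_ext a b : cH a = cH b -> cX a = cX b -> (forall i, cY a i = cY b i) ->
  (forall i, cZ a i = cZ b i) -> cW a = cW b -> a = b.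
Proof.
destruct a, b; simpl; intros; f_equal; auto; now apply functional_extensionality.
Qed.

Definition szero := SNvec 0 0 (fun _ => 0) (fun _ => 0) 0.
Definition sadd a b := SNvec (cH a + cH b) (cX a + cX b) (fun i => cY a i + cY b i)
  (fun i => cZ a i + cZ b i) (cW a + cW b).
Definition sscal t a := SNvec (t * cH a) (t * cX a) (fun i => t * cY a i) (fun i => t * cZ a i) (t * cW a).
Definition ssum k (g : nat -> sNvec) := SNvec (rsum k (fun l => cH (g l))) (rsum k (fun l => cX (g l)))
  (fun i => rsum k (fun l => cY (g l) i)) (fun i => rsum k (fun l => cZ (g l) i)) (rsum k (fun l => cW (g l))).

Section Model.
Variable m : nat.

Definition sN_ip a b :=
  cH a * cH b + cX a * cX b + ip m (cY a) (cY b) + ip m (cZ a) (cZ b) + cW a * cW b.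

Definition sN_br u v := SNvec 0 (2 * (cH u * cX v - cH v * cX u))
  (fun j => -2 * (cH u * cY v j - cH v * cY u j))
  (fun j => 2 * sqrt 2 * (cX u * cY v j - cX v * cY u j))
  (-2 * (cH u * cW v - cH v * cW u) + 2 * sqrt 2 * (ip m (cY u) (cZ v) - ip m (cY v) (cZ u))).

Definition sN_lc u v := SNvec (2 * cX u * cX v - 2 * ip m (cY u) (cY v) - 2 * cW u * cW v)
  (-2 * cH v * cX u + sqrt 2 * (ip m (cY v) (cZ u) + ip m (cY u) (cZ v)))
  (fun j => 2 * cH v * cY u j - sqrt 2 * (cX v * cZ u j + cX u * cZ v j)
            + sqrt 2 * (cW u * cZ v j + cW v * cZ u j))
  (fun j => sqrt 2 * (cX u * cY v j - cX v * cY u j - cW u * cY v j - cW v * cY u j))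
  (2 * cH v * cW u + sqrt 2 * (ip m (cY u) (cZ v) - ip m (cY v) (cZ u))).

Definition sN_curv t u v :=
  sadd (sadd (sN_lc t (sN_lc u v)) (sscal (-1) (sN_lc u (sN_lc t v)))) (sscal (-1) (sN_lc (sN_br t u) v)).

Lemma sN_lc_koszul a b d :
  (1/2) * (sN_ip (sN_br a b) d - sN_ip (sN_br b d) a + sN_ip (sN_br d a) b) = sN_ip (sN_lc a b) d.
Proof.
unfold sN_ip, sN_br, sN_lc. cbn [cH cX cY cZ cW]. ip_simpl.
rewrite ?(ip_comm m (cZ _) (cY _)), ?(ip_comm m (cY b) (cY a)), ?(ip_comm m (cY d) (cY a)),
  ?(ip_comm m (cY d) (cY b)), ?(ip_comm m (cZ b) (cZ a)), ?(ip_comm m (cZ d) (cZ a)), ?(ip_comm m (cZ d) (cZ b)).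
field.
Qed.

Lemma sN_lc_add_l p q v : sN_lc (sadd p q) v = sadd (sN_lc p v) (sN_lc q v).
Proof. apply sNvec_ext; simpl; intros; ip_simpl; ring. Qed.
Lemma sN_lc_scal_l t p v : sN_lc (sscal t p) v = sscal t (sN_lc p v).
Proof. apply sNvec_ext; simpl; intros; ip_simpl; ring. Qed.
Lemma sN_lc_add_r p q v : sN_lc v (sadd p q) = sadd (sN_lc v p) (sN_lc v q).
Proof. apply sNvec_ext; simpl; intros; ip_simpl; ring. Qed.
Lemma sN_lc_scal_r t p v : sN_lc v (sscal t p) = sscal t (sN_lc v p).
Proof. apply sNvec_ext; simpl; intros; ip_simpl; ring. Qed.
Lemma sN_br_add_l p q v : sN_br (sadd p q) v = sadd (sN_br p v) (sN_br q v).
Proof. apply sNvec_ext; simpl; intros; ip_simpl; ring. Qed.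
Lemma sN_br_scal_l t p v : sN_br (sscal t p) v = sscal t (sN_br p v).
Proof. apply sNvec_ext; simpl; intros; ip_simpl; ring. Qed.
Lemma sN_br_scal_r t p v : sN_br v (sscal t p) = sscal t (sN_br v p).
Proof. apply sNvec_ext; simpl; intros; ip_simpl; ring. Qed.

Lemma sN_curv_add_l t1 t2 u v : sN_curv (sadd t1 t2) u v = sadd (sN_curv t1 u v) (sN_curv t2 u v).
Proof.
unfold sN_curv. rewrite !sN_lc_add_l, sN_br_add_l, sN_lc_add_l, sN_lc_add_r.
apply sNvec_ext; simpl; intros; ring.
Qed.
Lemma sN_curv_scal_l t p u v : sN_curv (sscal t p) u v = sscal t (sN_curv p u v).
Proof.
unfold sN_curv. rewrite !sN_lc_scal_l, sN_br_scal_l, sN_lc_scal_l, sN_lc_scal_r.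
apply sNvec_ext; simpl; intros; ring.
Qed.
Lemma sN_curv_ssum_l k g u v : sN_curv (ssum k g) u v = ssum k (fun l => sN_curv (g l) u v).
Proof.
induction k as [|k IH].
- replace (ssum 0 g) with (sscal 0 szero) by (apply sNvec_ext; simpl; intros; ring).
  rewrite sN_curv_scal_l. apply sNvec_ext; simpl; intros; ring.
- change (ssum (S k) g) with (sadd (ssum k g) (g k)). rewrite sN_curv_add_l, IH. reflexivity.
Qed.

Lemma sN_ip_comm p q : sN_ip p q = sN_ip q p.
Proof. unfold sN_ip. rewrite (ip_comm m (cY p)), (ip_comm m (cZ p)). ring. Qed.
Lemma sN_ip_add_l p q r : sN_ip (sadd p q) r = sN_ip p r + sN_ip q r.
Proof. unfold sN_ip; simpl; ip_simpl; ring. Qed.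
Lemma sN_ip_scal_l t p q : sN_ip (sscal t p) q = t * sN_ip p q.
Proof. unfold sN_ip; simpl; ip_simpl; ring. Qed.
Lemma sN_ip_ssum_l k g q : sN_ip (ssum k g) q = rsum k (fun l => sN_ip (g l) q).
Proof.
induction k as [|k IH]; [unfold sN_ip; simpl; ip_simpl; ring|].
change (ssum (S k) g) with (sadd (ssum k g) (g k)). rewrite sN_ip_add_l, IH. reflexivity.
Qed.

Definition sN_der a := SNvec 0 (cX a) (fun _ => 0) (cZ a) (cW a).

Lemma sN_der_br a b : sN_der (sN_br a b) = sadd (sN_br (sN_der a) b) (sN_br a (sN_der b)).
Proof. apply sNvec_ext; simpl; intros; ip_simpl; ring. Qed.

Definition in_nilradical a := cH a = 0.
Definition in_span_ZW a := cH a = 0 /\ cX a = 0 /\ forall j, cY a j = 0.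

Definition linear_closed (Q : sNvec -> Prop) :=
  Q szero /\ (forall a b, Q a -> Q b -> Q (sadd a b)) /\ (forall t a, Q a -> Q (sscal t a)).

Lemma in_nilradical_closed : linear_closed in_nilradical.
Proof.
unfold in_nilradical. split; [|split]; simpl.
- reflexivity.
- intros a b -> ->. ring.
- intros t a ->. ring.
Qed.

Lemma in_span_ZW_closed : linear_closed in_span_ZW.
Proof.
unfold in_span_ZW. split; [|split]; simpl.
- repeat split.
- intros a b (Ha & Xa & Ya) (Hb & Xb & Yb). rewrite Ha, Hb, Xa, Xb. repeat split; try ring.
  intros j. rewrite Ya, Yb. ring.
- intros t a (Ha & Xa & Ya). rewrite Ha, Xa. repeat split; try ring.
  intros j. rewrite Ya. ring.
Qed.

Lemma eq_szero_closed : linear_closed (eq szero).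
Proof.
repeat split; intros; subst; apply sNvec_ext; simpl; intros; ring.
Qed.

Lemma sN_br_nilradical a b : in_nilradical (sN_br a b).
Proof. reflexivity. Qed.

Lemma sN_br_ZW a b : in_nilradical a -> in_nilradical b -> in_span_ZW (sN_br a b).
Proof. unfold in_nilradical, in_span_ZW; simpl; intros Ha Hb; rewrite Ha, Hb; repeat split; intros; ring. Qed.

Lemma sN_br_zero a b : in_span_ZW a -> in_span_ZW b -> sN_br a b = szero.
Proof.
intros (Ha & Xa & Ya) (Hb & Xb & Yb).
apply sNvec_ext; simpl; intros; rewrite ?Ha, ?Hb, ?Xa, ?Xb, ?Ya, ?Yb; try ring.
unfold ip. rewrite !rsum_eq0 by (intros; rewrite ?Ya, ?Yb; ring). ring.
Qed.

Definition sH := SNvec 1 0 (fun _ => 0) (fun _ => 0) 0.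
Definition sX := SNvec 0 1 (fun _ => 0) (fun _ => 0) 0.
Definition sY i := SNvec 0 0 (unitv i) (fun _ => 0) 0.
Definition sZ i := SNvec 0 0 (fun _ => 0) (unitv i) 0.
Definition sW := SNvec 0 0 (fun _ => 0) (fun _ => 0) 1.

Definition sN_basis k :=
  if k =? 0 then sH else if k =? 1 then sX else if k <? m + 2 then sY (k - 2)
  else if k <? 2 * m + 2 then sZ (k - (m + 2)) else sW.

Definition supported a := forall i, (m <= i)%nat -> cY a i = 0 /\ cZ a i = 0.

Lemma sN_basis_sY i : (i < m)%nat -> sN_basis (2 + i) = sY i.
Proof.
intros. unfold sN_basis.
destruct (Nat.eqb_spec (2 + i) 0), (Nat.eqb_spec (2 + i) 1), (Nat.ltb_spec (2 + i) (m + 2)); try lia.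
f_equal. lia.
Qed.
Lemma sN_basis_sZ i : (i < m)%nat -> sN_basis (2 + m + i) = sZ i.
Proof.
intros. unfold sN_basis.
destruct (Nat.eqb_spec (2 + m + i) 0), (Nat.eqb_spec (2 + m + i) 1),
  (Nat.ltb_spec (2 + m + i) (m + 2)), (Nat.ltb_spec (2 + m + i) (2 * m + 2)); try lia.
f_equal. lia.
Qed.
Lemma sN_basis_sW : sN_basis (2 + m + m) = sW.
Proof.
unfold sN_basis.
destruct (Nat.eqb_spec (2 + m + m) 0), (Nat.eqb_spec (2 + m + m) 1),
  (Nat.ltb_spec (2 + m + m) (m + 2)), (Nat.ltb_spec (2 + m + m) (2 * m + 2)); easy || lia.
Qed.

Lemma rsum_sN_basis (F : sNvec -> R) :
  rsum (2 * m + 3) (fun k => F (sN_basis k))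
  = F sH + F sX + rsum m (fun i => F (sY i)) + rsum m (fun i => F (sZ i)) + F sW.
Proof.
replace (2 * m + 3)%nat with (S (2 + m + m)) by lia.
change (rsum (S (2 + m + m)) ?g) with (rsum (2 + m + m) g + g (2 + m + m)%nat).
rewrite !rsum_split, sN_basis_sW.
rewrite (rsum_ext m (fun i => F (sN_basis (2 + i))) (fun i => F (sY i))) by (intros; now rewrite sN_basis_sY).
rewrite (rsum_ext m (fun i => F (sN_basis (2 + m + i))) (fun i => F (sZ i))) by (intros; now rewrite sN_basis_sZ).
simpl. change (sN_basis 0) with sH. change (sN_basis 1) with sX. ring.
Qed.

Lemma sN_ip_sH d : sN_ip d sH = cH d.
Proof. unfold sN_ip; simpl; ip_simpl; ring. Qed.
Lemma sN_ip_sX d : sN_ip d sX = cX d.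
Proof. unfold sN_ip; simpl; ip_simpl; ring. Qed.
Lemma sN_ip_sY d i : (i < m)%nat -> sN_ip d (sY i) = cY d i.
Proof. intros; unfold sN_ip; simpl; ip_simpl; rewrite ip_unitv_r by assumption; ring. Qed.
Lemma sN_ip_sZ d i : (i < m)%nat -> sN_ip d (sZ i) = cZ d i.
Proof. intros; unfold sN_ip; simpl; ip_simpl; rewrite ip_unitv_r by assumption; ring. Qed.
Lemma sN_ip_sW d : sN_ip d sW = cW d.
Proof. unfold sN_ip; simpl; ip_simpl; ring. Qed.

Lemma sN_basis_expansion d :
  supported d -> d = ssum (2 * m + 3) (fun k => sscal (sN_ip d (sN_basis k)) (sN_basis k)).
Proof.
intros Hd. apply sNvec_ext; intros; cbn [cH cX cY cZ cW ssum sscal].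
- rewrite (rsum_sN_basis (fun b => sN_ip d b * cH b)), sN_ip_sH; simpl.
  rewrite !rsum_eq0 by (intros; ring). ring.
- rewrite (rsum_sN_basis (fun b => sN_ip d b * cX b)), sN_ip_sX; simpl.
  rewrite !rsum_eq0 by (intros; ring). ring.
- rewrite (rsum_sN_basis (fun b => sN_ip d b * cY b i)); simpl.
  rewrite (rsum_eq0 m (fun j => sN_ip d (sZ j) * 0)) by (intros; ring).
  rewrite (rsum_ext m _ (fun j => unitv i j * cY d j))
    by (intros; rewrite sN_ip_sY by assumption; rewrite unitv_sym; ring).
  rewrite rsum_unitv_l. destruct (Nat.ltb_spec i m); [ring|]. rewrite (proj1 (Hd i H)); ring.
- rewrite (rsum_sN_basis (fun b => sN_ip d b * cZ b i)); simpl.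
  rewrite (rsum_eq0 m (fun j => sN_ip d (sY j) * 0)) by (intros; ring).
  rewrite (rsum_ext m _ (fun j => unitv i j * cZ d j))
    by (intros; rewrite sN_ip_sZ by assumption; rewrite unitv_sym; ring).
  rewrite rsum_unitv_l. destruct (Nat.ltb_spec i m); [ring|]. rewrite (proj2 (Hd i H)); ring.
- rewrite (rsum_sN_basis (fun b => sN_ip d b * cW b)), sN_ip_sW; simpl.
  rewrite !rsum_eq0 by (intros; ring). ring.
Qed.

(* Expand [d l] along [sN_basis] in the first slot of [R(., u) v], then use Parseval for [d]. *)
Lemma trace_curv_parseval (d : nat -> sNvec) u v :
  (forall l, (l < 2 * m + 3)%nat -> supported (d l)) ->
  (forall p q, rsum (2 * m + 3) (fun l => sN_ip p (d l) * sN_ip (d l) q) = sN_ip p q) ->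
  rsum (2 * m + 3) (fun l => sN_ip (sN_curv (d l) u v) (d l))
  = rsum (2 * m + 3) (fun k => sN_ip (sN_curv (sN_basis k) u v) (sN_basis k)).
Proof.
intros Hd Hparseval.
rewrite (rsum_ext _ _ (fun l => rsum (2 * m + 3) (fun k =>
    sN_ip (d l) (sN_basis k) * sN_ip (sN_curv (sN_basis k) u v) (d l)))).
2:{ intros l Hl. rewrite (sN_basis_expansion (d l)) at 1 by auto.
    rewrite sN_curv_ssum_l, sN_ip_ssum_l. apply rsum_ext; intros.
    rewrite sN_curv_scal_l, sN_ip_scal_l. reflexivity. }
rewrite rsum_swap. apply rsum_ext; intros k _.
rewrite (sN_ip_comm (sN_curv _ u v) (sN_basis k)), <- Hparseval.
apply rsum_ext; intros. rewrite (sN_ip_comm (d i) (sN_basis k)), (sN_ip_comm (d i) (sN_curv _ u v)).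
reflexivity.
Qed.
End Model.

(** * Curvature of the model *)

Section Ricci.
Variable m : nat.

Lemma sN_lc_sH v : sN_lc m sH v = szero.
Proof. apply sNvec_ext; simpl; intros; ip_simpl; ring. Qed.
Lemma sN_lc_sX v : sN_lc m sX v =
  SNvec (2 * cX v) (-2 * cH v) (fun j => - sqrt 2 * cZ v j) (fun j => sqrt 2 * cY v j) 0.
Proof. apply sNvec_ext; simpl; intros; ip_simpl; ring. Qed.
Lemma sN_lc_sY i v : (i < m)%nat -> sN_lc m (sY i) v =
  SNvec (-2 * cY v i) (sqrt 2 * cZ v i) (fun j => 2 * cH v * unitv i j)
    (fun j => - sqrt 2 * (cX v + cW v) * unitv i j) (sqrt 2 * cZ v i).
Proof. intros; apply sNvec_ext; simpl; intros; ip_simpl; rewrite ?ip_unitv_l, ?ip_unitv_r by auto; ring. Qed.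
Lemma sN_lc_sZ i v : (i < m)%nat -> sN_lc m (sZ i) v =
  SNvec 0 (sqrt 2 * cY v i) (fun j => sqrt 2 * (cW v - cX v) * unitv i j) (fun _ => 0) (- sqrt 2 * cY v i).
Proof. intros; apply sNvec_ext; simpl; intros; ip_simpl; rewrite ?ip_unitv_l, ?ip_unitv_r by auto; ring. Qed.
Lemma sN_lc_sW v : sN_lc m sW v =
  SNvec (-2 * cW v) 0 (fun j => sqrt 2 * cZ v j) (fun j => - sqrt 2 * cY v j) (2 * cH v).
Proof. apply sNvec_ext; simpl; intros; ip_simpl; ring. Qed.

Lemma sN_br_sH v : sN_br m sH v = SNvec 0 (2 * cX v) (fun j => -2 * cY v j) (fun _ => 0) (-2 * cW v).
Proof. apply sNvec_ext; simpl; intros; ip_simpl; ring. Qed.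
Lemma sN_br_sX v : sN_br m sX v = SNvec 0 (-2 * cH v) (fun _ => 0) (fun j => 2 * sqrt 2 * cY v j) 0.
Proof. apply sNvec_ext; simpl; intros; ip_simpl; ring. Qed.
Lemma sN_br_sY i v : (i < m)%nat -> sN_br m (sY i) v =
  SNvec 0 0 (fun j => 2 * cH v * unitv i j) (fun j => -2 * sqrt 2 * cX v * unitv i j) (2 * sqrt 2 * cZ v i).
Proof. intros; apply sNvec_ext; simpl; intros; ip_simpl; rewrite ?ip_unitv_l, ?ip_unitv_r by auto; ring. Qed.
Lemma sN_br_sZ i v : (i < m)%nat -> sN_br m (sZ i) v = SNvec 0 0 (fun _ => 0) (fun _ => 0) (-2 * sqrt 2 * cY v i).
Proof. intros; apply sNvec_ext; simpl; intros; ip_simpl; rewrite ?ip_unitv_l, ?ip_unitv_r by auto; ring. Qed.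
Lemma sN_br_sW v : sN_br m sW v = SNvec 0 0 (fun _ => 0) (fun _ => 0) (2 * cH v).
Proof. apply sNvec_ext; simpl; intros; ip_simpl; ring. Qed.

Ltac curv_simpl a b :=
  cbn [cH cX cY cZ cW sadd sscal szero]; unfold sN_lc; cbn [cH cX cY cZ cW szero];
  ip_simpl; rewrite ?unitv_diag, ?ip_unitv_l, ?ip_unitv_r by auto;
  rewrite ?(ip_comm m (cY b) (cY a)), ?(ip_comm m (cZ b) (cZ a));
  ring_simplify; rewrite ?sqrt2_sq; ring.

Lemma sN_curv_sH a b : cH (sN_curv m sH a b) = -4 * cX a * cX b - 4 * cW a * cW b - 4 * ip m (cY a) (cY b).
Proof. unfold sN_curv. rewrite !sN_lc_sH, sN_br_sH. curv_simpl a b. Qed.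
Lemma sN_curv_sX a b : cX (sN_curv m sX a b) =
  -2 * ip m (cY a) (cY b) + 4 * cW a * cW b + 2 * ip m (cZ a) (cZ b) - 4 * cH a * cH b.
Proof. unfold sN_curv. rewrite !sN_lc_sX, sN_br_sX. curv_simpl a b. Qed.
Lemma sN_curv_sY i a b : (i < m)%nat -> cY (sN_curv m (sY i) a b) i =
  -2 * cX a * cX b + 2 * cX a * cW b + 2 * cX b * cW a - 2 * cW a * cW b
  - 4 * ip m (cY a) (cY b) - 4 * cH a * cH b + 4 * (cY a i * cY b i) - 4 * (cZ a i * cZ b i).
Proof. intros. unfold sN_curv. rewrite !sN_lc_sY, sN_br_sY by auto. curv_simpl a b. Qed.
Lemma sN_curv_sZ i a b : (i < m)%nat -> cZ (sN_curv m (sZ i) a b) i =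
  - 2 * cX a * cW b + 2 * cX a * cX b + 2 * cW a * cW b - 2 * cX b * cW a - 4 * (cY a i * cY b i).
Proof. intros. unfold sN_curv. rewrite !sN_lc_sZ, sN_br_sZ by auto. curv_simpl a b. Qed.
Lemma sN_curv_sW a b : cW (sN_curv m sW a b) =
  4 * cX a * cX b - 2 * ip m (cY a) (cY b) + 2 * ip m (cZ a) (cZ b) - 4 * cH a * cH b.
Proof. unfold sN_curv. rewrite !sN_lc_sW, sN_br_sW. curv_simpl a b. Qed.

Definition ricci_const := 4 * INR m + 8.

Lemma sN_ricci_trace a b :
  rsum (2 * m + 3) (fun k => sN_ip m (sN_curv m (sN_basis m k) a b) (sN_basis m k))
  = - ricci_const * (cH a * cH b + ip m (cY a) (cY b)).
Proof.
rewrite (rsum_sN_basis m (fun e => sN_ip m (sN_curv m e a b) e)).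
rewrite sN_ip_sH, sN_ip_sX, sN_ip_sW, sN_curv_sH, sN_curv_sX, sN_curv_sW.
rewrite (rsum_ext m (fun i => sN_ip m (sN_curv m (sY i) a b) (sY i)) (fun i =>
    -2 * cX a * cX b + 2 * cX a * cW b + 2 * cX b * cW a - 2 * cW a * cW b
    - 4 * ip m (cY a) (cY b) - 4 * cH a * cH b + 4 * (cY a i * cY b i) - 4 * (cZ a i * cZ b i)))
  by (intros; now rewrite sN_ip_sY, sN_curv_sY).
rewrite (rsum_ext m (fun i => sN_ip m (sN_curv m (sZ i) a b) (sZ i)) (fun i =>
    - 2 * cX a * cW b + 2 * cX a * cX b + 2 * cW a * cW b - 2 * cX b * cW a - 4 * (cY a i * cY b i)))
  by (intros; now rewrite sN_ip_sZ, sN_curv_sZ).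
rewrite !rsum_sub, !rsum_add, !rsum_scal_l, !rsum_const.
unfold ip, ricci_const. ring.
Qed.

Definition sN_ric a := sadd (sscal (- ricci_const) a) (sscal ricci_const (sN_der a)).

End Ricci.

(** * The bracket of s in coordinates *)

Section Bracket.
Variable m : nat.
Local Notation n := (S m).

Variant index_spec : nat -> Prop :=
  | IndexA1 : index_spec 0
  | IndexA2 : index_spec 1
  | IndexX : index_spec 2
  | IndexY i : (i < m)%nat -> index_spec (3 + i)
  | IndexZ i : (i < m)%nat -> index_spec (n + 2 + i)
  | IndexW : index_spec (2 * n + 1)
  | IndexOut k : (sdim n <= k)%nat -> index_spec k.

Lemma indexP k : index_spec k.
Proof.
destruct (Nat.lt_ge_cases k 3) as [Hk|Hk].
{ destruct k as [|[|[|k]]]; [constructor..|lia]. }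
destruct (Nat.lt_ge_cases k (n + 2)).
{ replace k with (3 + (k - 3))%nat by lia. constructor. lia. }
destruct (Nat.lt_ge_cases k (2 * n + 1)).
{ replace k with (n + 2 + (k - (n + 2)))%nat by lia. constructor. lia. }
destruct (Nat.eq_dec k (2 * n + 1)) as [->|]; constructor. unfold sdim. lia.
Qed.

Definition sbr_coord (u v : vec) : vec := fun k =>
  if k =? 2 then cc * (u 0%nat * v 2%nat - v 0%nat * u 2%nat)
  else if isY n k then - (cc/2) * (u 0%nat * v k - v 0%nat * u k) + (cc/2) * (u 1%nat * v k - v 1%nat * u k)
  else if isZ n k then (cc/2) * (u 0%nat * v k - v 0%nat * u k) + (cc/2) * (u 1%nat * v k - v 1%nat * u k)
        + cc * (u 2%nat * v (k - m)%nat - v 2%nat * u (k - m)%nat)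
  else if k =? 2 * n + 1 then cc * (u 1%nat * v k - v 1%nat * u k)
        + cc * rsum m (fun i => u (3 + i)%nat * v (n + 2 + i)%nat - v (3 + i)%nat * u (n + 2 + i)%nat)
  else 0.

Lemma sbr_coord_anti u v k : sbr_coord v u k = - sbr_coord u v k.
Proof.
unfold sbr_coord.
rewrite (rsum_ext m _ (fun i => -1 * (u (3 + i)%nat * v (n + 2 + i)%nat - v (3 + i)%nat * u (n + 2 + i)%nat)))
  by (intros; ring).
rewrite rsum_scal_l. destruct_ifs; ring.
Qed.

Lemma sbr_coord_add_l u u' v k : sbr_coord (vadd u u') v k = sbr_coord u v k + sbr_coord u' v k.
Proof.
unfold sbr_coord, vadd.
rewrite (rsum_ext m _ (fun i => u (3 + i)%nat * v (n + 2 + i)%nat - v (3 + i)%nat * u (n + 2 + i)%nat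
   + (u' (3 + i)%nat * v (n + 2 + i)%nat - v (3 + i)%nat * u' (n + 2 + i)%nat))) by (intros; ring).
rewrite rsum_add.
destruct_ifs; ring.
Qed.

Lemma sbr_coord_scal_l t u v k : sbr_coord (vscal t u) v k = t * sbr_coord u v k.
Proof.
unfold sbr_coord, vscal.
rewrite (rsum_ext m _ (fun i => t * (u (3 + i)%nat * v (n + 2 + i)%nat - v (3 + i)%nat * u (n + 2 + i)%nat)))
  by (intros; ring).
rewrite rsum_scal_l. destruct_ifs; ring.
Qed.

Lemma sbr_coord_vsum_l K g v k : sbr_coord (vsum K g) v k = rsum K (fun i => sbr_coord (g i) v k).
Proof.
induction K as [|K IH].
- unfold sbr_coord, vsum. cbn [rsum]. rewrite rsum_eq0 by (intros; ring).
  destruct_ifs; ring.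
- change (vsum (S K) g) with (vadd (vsum K g) (g K)). rewrite sbr_coord_add_l, IH. reflexivity.
Qed.

Lemma sbr_coord_local u u' v k : (forall i, (i < sdim n)%nat -> u i = u' i) ->
  sbr_coord u v k = sbr_coord u' v k.
Proof.
intros E. unfold sdim in E. unfold sbr_coord.
rewrite (rsum_ext m _ (fun i => u' (3 + i)%nat * v (n + 2 + i)%nat - v (3 + i)%nat * u' (n + 2 + i)%nat))
  by (intros; rewrite !E by lia; reflexivity).
unfold isY, isZ. nat_cases; rewrite ?E by lia; reflexivity.
Qed.

Lemma br_lt_coord a b k : (a < b)%nat -> br_lt n a b k = sbr_coord (unitv a) (unitv b) k.
Proof.
intros Hab. unfold sbr_coord. rewrite rsum_sub.
rewrite (rsum_unitv_shift m a 3 (fun i => unitv b (n + 2 + i)%nat)).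
rewrite (rsum_unitv_shift m b 3 (fun i => unitv a (n + 2 + i)%nat)).
replace (S m - 1)%nat with m by lia.
unfold br_lt, isY, isZ, vscal, vzero, unitv.
nat_cases; ring.
Qed.

Lemma br_basis_coord a b k : br_basis n a b k = sbr_coord (unitv a) (unitv b) k.
Proof.
unfold br_basis. destruct (Nat.ltb_spec a b); [now apply br_lt_coord|].
destruct (Nat.ltb_spec b a).
- unfold vscal. rewrite br_lt_coord, sbr_coord_anti by assumption. ring.
- replace b with a by lia. pose proof (sbr_coord_anti (unitv a) (unitv a) k). unfold vzero. lra.
Qed.

Lemma sbr_coord_expand_l u v k : sbr_coord u v k = rsum (sdim n) (fun i => u i * sbr_coord (unitv i) v k).
Proof.
rewrite (sbr_coord_local u (vsum (sdim n) (fun i => vscal (u i) (unitv i)))).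
- rewrite sbr_coord_vsum_l. apply rsum_ext; intros. apply sbr_coord_scal_l.
- intros i Hi. unfold vsum, vscal.
  rewrite (rsum_ext _ _ (fun l => u l * unitv i l)) by (intros; now rewrite unitv_sym).
  rewrite rsum_unitv_r.
  destruct (Nat.ltb_spec i (sdim n)); [reflexivity|lia].
Qed.

Lemma sbr_coord_expand_r u v k : sbr_coord u v k = rsum (sdim n) (fun j => v j * sbr_coord u (unitv j) k).
Proof.
rewrite sbr_coord_anti, sbr_coord_expand_l.
rewrite (rsum_ext _ (fun j => v j * sbr_coord u (unitv j) k) (fun j => -1 * (v j * sbr_coord (unitv j) u k)))
  by (intros; rewrite (sbr_coord_anti (unitv _) u); ring).
rewrite rsum_scal_l. ring.
Qed.

Lemma sbr_eq_coord u v : sbr n u v = sbr_coord u v.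
Proof.
apply functional_extensionality; intros k.
unfold sbr, vsum, vscal. rewrite sbr_coord_expand_l. apply rsum_ext; intros i _.
rewrite sbr_coord_expand_r, <- rsum_scal_l. apply rsum_ext; intros j _.
rewrite br_basis_coord. ring.
Qed.
End Bracket.

(** * Transport to an arbitrary orthonormal basis of s_N *)

Section Embedding.
Variable m : nat.
Local Notation n := (S m).

Definition sN_emb (a : sNvec) : vec := fun k =>
  if k =? 0 then cH a / sqrt 2 else if k =? 1 then - (cH a / sqrt 2) else if k =? 2 then cX a
  else if isY n k then cY a (k - 3) else if isZ n k then cZ a (k - (n + 2))
  else if k =? 2 * n + 1 then cW a else 0.

(* The junk entries [cY i], [cZ i] with [m <= i] are set to 0. *)
Definition sN_coord (u : vec) : sNvec := SNvec ((u 0%nat - u 1%nat) / sqrt 2) (u 2%nat)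
  (fun i => if i <? m then u (3 + i)%nat else 0)
  (fun i => if i <? m then u (n + 2 + i)%nat else 0) (u (2 * n + 1)%nat).

Lemma sN_emb_A1 a : sN_emb a 0%nat = cH a / sqrt 2.
Proof. reflexivity. Qed.
Lemma sN_emb_A2 a : sN_emb a 1%nat = - (cH a / sqrt 2).
Proof. reflexivity. Qed.
Lemma sN_emb_X a : sN_emb a 2%nat = cX a.
Proof. reflexivity. Qed.
Lemma sN_emb_Y a i : (i < m)%nat -> sN_emb a (3 + i)%nat = cY a i.
Proof. intros. unfold sN_emb, isY, isZ. nat_cases. f_equal. lia. Qed.
Lemma sN_emb_Z a i : (i < m)%nat -> sN_emb a (n + 2 + i)%nat = cZ a i.
Proof. intros. unfold sN_emb, isY, isZ. nat_cases. f_equal. lia. Qed.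
Lemma sN_emb_W a : sN_emb a (2 * n + 1)%nat = cW a.
Proof. unfold sN_emb, isY, isZ. nat_cases. reflexivity. Qed.
Lemma sN_emb_out a k : (sdim n <= k)%nat -> sN_emb a k = 0.
Proof. unfold sdim; intros. unfold sN_emb, isY, isZ. nat_cases. reflexivity. Qed.

End Embedding.

Ltac sN_emb_simpl := rewrite ?sN_emb_A1, ?sN_emb_A2, ?sN_emb_X, ?sN_emb_Y, ?sN_emb_Z, ?sN_emb_W by assumption.

Section EmbeddingAlgebra.
Variable m : nat.
Local Notation n := (S m).

Lemma sN_emb_zero : sN_emb m szero = vzero.
Proof. apply functional_extensionality; intros k. unfold sN_emb, vzero; simpl. destruct_ifs; unfold Rdiv; ring. Qed.

Lemma sN_emb_add a b : sN_emb m (sadd a b) = vadd (sN_emb m a) (sN_emb m b).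
Proof.
apply functional_extensionality; intros k. unfold vadd.
destruct (indexP m k); sN_emb_simpl; rewrite ?sN_emb_out by assumption; simpl; unfold Rdiv; ring.
Qed.

Lemma sN_emb_scal t a : sN_emb m (sscal t a) = vscal t (sN_emb m a).
Proof.
apply functional_extensionality; intros k. unfold vscal.
destruct (indexP m k); sN_emb_simpl; rewrite ?sN_emb_out by assumption; simpl; unfold Rdiv; ring.
Qed.

Lemma sN_emb_coord u : (forall i, (sdim n <= i)%nat -> u i = 0) -> u 0%nat + u 1%nat = 0 ->
  sN_emb m (sN_coord m u) = u.
Proof.
intros Hout H01. apply functional_extensionality; intros k.
destruct (indexP m k); sN_emb_simpl; rewrite ?sN_emb_out by assumption; simpl;
  unfold sdim in *; nat_cases; rewrite ?Hout by (unfold sdim; lia); try reflexivity.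
- replace (u 1%nat) with (- u 0%nat) by lra. field_sqrt2.
- replace (u 0%nat) with (- u 1%nat) by lra. field_sqrt2.
Qed.

Lemma sN_coord_supported u : supported m (sN_coord m u).
Proof. intros i Hi. simpl. nat_cases. split; reflexivity. Qed.

Lemma sbr_coord_emb a b : sbr_coord m (sN_emb m a) (sN_emb m b) = sN_emb m (sN_br m a b).
Proof.
pose proof sqrt2_neq_0 as Hsqrt2.
apply functional_extensionality; intros k.
destruct (indexP m k); unfold sbr_coord, isY, isZ; unfold sdim in *; nat_cases;
  try replace (S m + 2 + i - m)%nat with (3 + i)%nat by lia;
  sN_emb_simpl; rewrite ?sN_emb_out by (unfold sdim; lia);
  cbn [cH cX cY cZ cW sN_br]; unfold cc; try (field; assumption).
rewrite (rsum_ext m _ (fun i => cY a i * cZ b i - cY b i * cZ a i)) by (intros; now sN_emb_simpl).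
rewrite rsum_sub. unfold ip. field. assumption.
Qed.
End EmbeddingAlgebra.

Section Transfer.
Variable m : nat.
Local Notation n := (S m).

Lemma sbr_emb a b : sbr n (sN_emb m a) (sN_emb m b) = sN_emb m (sN_br m a b).
Proof. now rewrite sbr_eq_coord, sbr_coord_emb. Qed.

Lemma ip_emb a b : ip (sdim n) (sN_emb m a) (sN_emb m b) = sN_ip m a b.
Proof.
unfold ip, sdim. replace (2 * n + 2)%nat with (S (3 + m + m)) by lia.
change (rsum (S ?k) ?g) with (rsum k g + g k).
rewrite !rsum_split. replace (3 + m + m)%nat with (2 * n + 1)%nat by lia.
rewrite (rsum_ext m (fun i => sN_emb m a (3 + i)%nat * sN_emb m b (3 + i)%nat) (fun i => cY a i * cY b i))
  by (intros; now rewrite !sN_emb_Y).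
rewrite (rsum_ext m (fun i => sN_emb m a (3 + m + i)%nat * sN_emb m b (3 + m + i)%nat) (fun i => cZ a i * cZ b i))
  by (intros; replace (3 + m + i)%nat with (n + 2 + i)%nat by lia; now rewrite !sN_emb_Z).
simpl rsum. rewrite !sN_emb_A1, !sN_emb_A2, !sN_emb_X, !sN_emb_W.
unfold sN_ip, ip. field_sqrt2.
Qed.

Lemma ip_Nvec u : ip (sdim n) u Nvec = - (1 / sqrt 2) * (u 0%nat + u 1%nat).
Proof.
unfold ip, sdim. replace (2 * n + 2)%nat with (2 + 2 * n)%nat by lia. rewrite rsum_split.
rewrite (rsum_eq0 (2 * n)) by (intros; unfold Nvec; simpl; ring).
simpl. unfold Nvec. simpl. ring.
Qed.

Lemma ip_emb_Nvec a : ip (sdim n) (sN_emb m a) Nvec = 0.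
Proof. rewrite ip_Nvec, sN_emb_A1, sN_emb_A2. ring. Qed.

Lemma ip_Nvec_Nvec : ip (sdim n) Nvec Nvec = 1.
Proof.
rewrite ip_Nvec. unfold Nvec; simpl. field_sqrt2.
Qed.

Variable f : nat -> vec.
Hypothesis Hf : ONB_sN n f.

(* [f_0, ..., f_(2n), N] is an orthonormal basis of R^(sdim n), hence its columns are orthonormal. *)
Lemma ONB_sN_columns i j : (i < sdim n)%nat -> (j < sdim n)%nat ->
  rsum (2 * n + 1) (fun l => f l i * f l j) = (if i =? j then 1 else 0) - Nvec i * Nvec j.
Proof.
intros Hi Hj. destruct Hf as (_ & Horth & HN).
set (F := fun a => if a <? 2 * n + 1 then f a else Nvec).
assert (Hrows : forall a b, (a < sdim n)%nat -> (b < sdim n)%nat ->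
   rsum (sdim n) (fun i => Rmult (F a i) (F b i)) = if a =? b then R1 else R0).
{ intros a b Ha Hb. unfold F, sdim in *.
  destruct (Nat.ltb_spec a (2 * n + 1)), (Nat.ltb_spec b (2 * n + 1)).
  - now apply Horth.
  - change (ip (sdim n) (f a) Nvec = if a =? b then 1 else 0).
    rewrite HN by assumption. destruct (Nat.eqb_spec a b); [lia|reflexivity].
  - change (ip (sdim n) Nvec (f b) = if a =? b then 1 else 0).
    rewrite ip_comm, HN by assumption. destruct (Nat.eqb_spec a b); [lia|reflexivity].
  - change (ip (sdim n) Nvec Nvec = if a =? b then 1 else 0).
    rewrite ip_Nvec_Nvec. destruct (Nat.eqb_spec a b); [reflexivity|lia]. }
pose proof (OrthonormalColumns.orthonormal_cols (sdim n) F Hrows i j Hi Hj) as E.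
unfold sdim in E. replace (2 * n + 2)%nat with (S (2 * n + 1)) in E by lia.
cbn [rsum] in E. unfold F at 3 4 in E. rewrite Nat.ltb_irrefl in E.
rewrite (rsum_ext _ _ (fun l => f l i * f l j)) in E.
2:{ intros l Hl. unfold F. now rewrite (proj2 (Nat.ltb_lt l _) Hl). }
change R1 with 1 in E. change R0 with 0 in E. lra.
Qed.

Lemma ONB_sN_expand w i : (forall j, (sdim n <= j)%nat -> w j = 0) ->
  rsum (2 * n + 1) (fun l => ip (sdim n) w (f l) * f l i) = w i - ip (sdim n) w Nvec * Nvec i.
Proof.
intros Hw. destruct (Nat.lt_ge_cases i (sdim n)) as [Hi|Hi].
- unfold ip.
  rewrite (rsum_ext (2 * n + 1) _ (fun l => rsum (sdim n) (fun j => w j * (f l j * f l i))))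
    by (intros; rewrite <- rsum_scal_r; apply rsum_ext; intros; ring).
  rewrite rsum_swap.
  rewrite (rsum_ext (sdim n) _ (fun j => w j * unitv i j - (w j * Nvec j) * Nvec i)).
  2:{ intros j Hj. rewrite rsum_scal_l, ONB_sN_columns by assumption. unfold unitv. ring. }
  rewrite rsum_sub, rsum_unitv_r, rsum_scal_r. now rewrite (proj2 (Nat.ltb_lt i _) Hi).
- destruct Hf as (Hout & _). rewrite rsum_eq0 by (intros; rewrite Hout by assumption; ring).
  rewrite Hw by assumption. unfold Nvec, sdim in *. nat_cases. ring.
Qed.

Lemma ONB_sN_expand_emb a : vsum (2 * n + 1) (fun l => vscal (ip (sdim n) (sN_emb m a) (f l)) (f l)) = sN_emb m a.
Proof.
apply functional_extensionality; intros i. unfold vsum, vscal.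
rewrite ONB_sN_expand, ip_emb_Nvec by (intros; now apply sN_emb_out). ring.
Qed.

Lemma ONB_sN_A1A2 l : (l < 2 * n + 1)%nat -> f l 0%nat + f l 1%nat = 0.
Proof.
intros Hl. destruct Hf as (_ & _ & HN). pose proof (HN l Hl) as E.
rewrite ip_Nvec in E. pose proof (Rinv_neq_0_compat _ sqrt2_neq_0).
apply Rmult_integral in E as [E|E]; [|assumption]. exfalso. unfold Rdiv in E. lra.
Qed.

Lemma ONB_sN_emb l : (l < 2 * n + 1)%nat -> f l = sN_emb m (sN_coord m (f l)).
Proof.
intros Hl. symmetry. apply sN_emb_coord; [|now apply ONB_sN_A1A2].
intros; now apply (proj1 Hf).
Qed.

Lemma ONB_sN_parseval p q :
  rsum (2 * n + 1) (fun l => sN_ip m p (sN_coord m (f l)) * sN_ip m (sN_coord m (f l)) q) = sN_ip m p q.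
Proof.
rewrite (rsum_ext _ _ (fun l => rsum (sdim n) (fun j => ip (sdim n) (sN_emb m p) (f l) * f l j * sN_emb m q j))).
2:{ intros l Hl. rewrite <- !ip_emb, <- ONB_sN_emb by assumption.
    change (ip (sdim n) (f l) (sN_emb m q)) with (rsum (sdim n) (fun j => f l j * sN_emb m q j)).
    rewrite <- rsum_scal_l. apply rsum_ext; intros; ring. }
rewrite rsum_swap, <- ip_emb. apply rsum_ext; intros j _.
rewrite rsum_scal_r. f_equal. exact (f_equal (fun v => v j) (ONB_sN_expand_emb p)).
Qed.

Lemma lc_emb a b : lc (sbr n) (ip (sdim n)) f (2 * n + 1) (sN_emb m a) (sN_emb m b) = sN_emb m (sN_lc m a b).
Proof.
unfold lc. rewrite <- (ONB_sN_expand_emb (sN_lc m a b)).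
apply functional_extensionality; intros i. unfold vsum, vscal.
apply rsum_ext; intros l Hl. f_equal.
rewrite (ONB_sN_emb l Hl), !sbr_emb, !ip_emb. apply sN_lc_koszul.
Qed.

Lemma curv_emb a b c :
  curv (sbr n) (ip (sdim n)) f (2 * n + 1) (sN_emb m a) (sN_emb m b) (sN_emb m c) = sN_emb m (sN_curv m a b c).
Proof.
unfold curv, sN_curv. rewrite !lc_emb, sbr_emb, !lc_emb, !sN_emb_add, !sN_emb_scal. reflexivity.
Qed.

Lemma ric_emb a b : ric (sbr n) (ip (sdim n)) f (2 * n + 1) (sN_emb m a) (sN_emb m b)
  = - ricci_const m * (cH a * cH b + ip m (cY a) (cY b)).
Proof.
unfold ric.
rewrite (rsum_ext _ _ (fun l => sN_ip m (sN_curv m (sN_coord m (f l)) a b) (sN_coord m (f l)))).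
2:{ intros l Hl. rewrite (ONB_sN_emb l Hl) at 1 2. now rewrite curv_emb, ip_emb. }
replace (2 * n + 1)%nat with (2 * m + 3)%nat by lia.
rewrite trace_curv_parseval; [apply sN_ricci_trace| intros; apply sN_coord_supported |].
replace (2 * m + 3)%nat with (2 * n + 1)%nat by lia. apply ONB_sN_parseval.
Qed.

Lemma ric_op_emb a : ric_op (sbr n) (ip (sdim n)) f (2 * n + 1) (sN_emb m a) = sN_emb m (sN_ric m a).
Proof.
unfold ric_op. rewrite <- (ONB_sN_expand_emb (sN_ric m a)).
apply functional_extensionality; intros i. unfold vsum, vscal. apply rsum_ext; intros l Hl. f_equal.
rewrite (ONB_sN_emb l Hl), ric_emb, ip_emb.
unfold sN_ip, sN_ric, sN_der. cbn [cH cX cY cZ cW sadd sscal]. ip_simpl. ring.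
Qed.
End Transfer.

Section Soliton.
Variable m : nat.
Local Notation n := (S m).

Definition ricci_der (x : vec) : vec := fun i =>
  if ((i =? 2) || isZ n i || (i =? 2 * n + 1))%bool then ricci_const m * x i else 0.

Lemma ricci_der_emb a : ricci_der (sN_emb m a) = sN_emb m (sscal (ricci_const m) (sN_der a)).
Proof.
apply functional_extensionality; intros k.
destruct (indexP m k); unfold ricci_der, isZ; unfold sdim in *; nat_cases; sN_emb_simpl;
  rewrite ?sN_emb_out by (unfold sdim; lia); simpl; unfold Rdiv; ring.
Qed.

Lemma ricci_const_pos : 0 < ricci_const m.
Proof. unfold ricci_const. pose proof (pos_INR m). lra. Qed.

Variable f : nat -> vec.
Hypothesis Hf : ONB_sN n f.

Lemma inV_emb x : inV f (2 * n + 1) x -> x = sN_emb m (sN_coord m x).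
Proof.
intros [c Hc]. destruct Hf as (Hout & _).
symmetry. apply sN_emb_coord.
- intros i Hi. rewrite Hc. apply rsum_eq0. intros l Hl. unfold vscal. rewrite Hout by assumption. ring.
- rewrite !Hc. unfold vsum, vscal. rewrite <- rsum_add. apply rsum_eq0. intros l Hl.
  rewrite <- Rmult_plus_distr_l, (ONB_sN_A1A2 m f Hf l Hl). ring.
Qed.

Lemma emb_inV a : inV f (2 * n + 1) (sN_emb m a).
Proof.
exists (fun l => ip (sdim n) (sN_emb m a) (f l)). intros i.
now rewrite (ONB_sN_expand_emb m f Hf a).
Qed.

Lemma ricci_der_derivation : is_derivation (sbr n) f (2 * n + 1) ricci_der.
Proof.
split; [|split].
- intros x Hx. rewrite (inV_emb x Hx), ricci_der_emb. apply emb_inV.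
- intros s t x y _ _ i. unfold ricci_der, vadd, vscal. destruct_ifs; ring.
- intros x y Hx Hy i. rewrite (inV_emb x Hx), (inV_emb y Hy), !sbr_emb, !ricci_der_emb, !sbr_emb.
  rewrite <- sN_emb_add. f_equal. f_equal.
  rewrite sN_der_br, sN_br_scal_l, sN_br_scal_r. apply sNvec_ext; simpl; intros; ring.
Qed.

Lemma ric_op_soliton x : inV f (2 * n + 1) x ->
  veq (ric_op (sbr n) (ip (sdim n)) f (2 * n + 1) x) (vadd (vscal (- ricci_const m) x) (ricci_der x)).
Proof.
intros Hx. rewrite (inV_emb x Hx), ric_op_emb, ricci_der_emb by assumption.
unfold sN_ric. rewrite sN_emb_add, sN_emb_scal. intros i. reflexivity.
Qed.

Lemma derived_emb (P : vec -> Prop) (Q Q' : sNvec -> Prop) :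
  (forall x, P x -> exists a, x = sN_emb m a /\ Q a) ->
  (forall a b, Q a -> Q b -> Q' (sN_br m a b)) -> linear_closed Q' ->
  forall x, derived (sbr n) P x -> exists a, x = sN_emb m a /\ Q' a.
Proof.
intros HP Hbr (Hzero & Hadd & Hscal) x Hx.
induction Hx as [x y Px Py| |x y _ [a [-> Ha]] _ [b [-> Hb]] |t x _ [a [-> Ha]]|x y Exy _ [a [-> Ha]]].
- destruct (HP x Px) as [a [-> Ha]], (HP y Py) as [b [-> Hb]].
  exists (sN_br m a b). split; [apply sbr_emb|auto].
- exists szero. split; [symmetry; apply sN_emb_zero|assumption].
- exists (sadd a b). split; [symmetry; apply sN_emb_add|auto].
- exists (sscal t a). split; [symmetry; apply sN_emb_scal|auto].
- exists a. split; [|assumption]. apply functional_extensionality; intros i. now rewrite <- Exy.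
Qed.

Lemma sbr_solvable : solvable (sbr n) f (2 * n + 1).
Proof.
assert (D1 : forall x, derser (sbr n) f (2 * n + 1) 1 x -> exists a, x = sN_emb m a /\ in_nilradical a).
{ apply (derived_emb _ (fun _ => True)); [|intros; apply sN_br_nilradical|apply in_nilradical_closed].
  intros x Hx. exists (sN_coord m x). split; [now apply inV_emb|exact I]. }
assert (D2 : forall x, derser (sbr n) f (2 * n + 1) 2 x -> exists a, x = sN_emb m a /\ in_span_ZW a).
{ apply (derived_emb _ _ _ D1); [apply sN_br_ZW|apply in_span_ZW_closed]. }
assert (D3 : forall x, derser (sbr n) f (2 * n + 1) 3 x -> exists a, x = sN_emb m a /\ szero = a).
{ apply (derived_emb _ _ _ D2); [|apply eq_szero_closed]. intros. symmetry. now apply sN_br_zero. }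
exists 3%nat. intros x Hx. destruct (D3 x Hx) as [a [-> <-]]. now rewrite sN_emb_zero.
Qed.

Lemma sbr_not_einstein : (1 <= m)%nat -> ~ einstein (sbr n) (ip (sdim n)) f (2 * n + 1).
Proof.
intros Hm [c Hc].
pose proof (Hc _ (emb_inV sX) 2%nat) as EX.
pose proof (Hc _ (emb_inV (sY 0)) 3%nat) as EY.
rewrite ric_op_emb in EX, EY by assumption. unfold vscal in EX, EY.
rewrite !sN_emb_X in EX. rewrite !(sN_emb_Y m _ 0) in EY by lia.
unfold sN_ric, sN_der in EX, EY. simpl in EX, EY. rewrite unitv_diag in EY.
pose proof ricci_const_pos. nra.
Qed.
End Soliton.

Theorem proposition5p7 :
  forall (n : nat), (2 <= n)%nat ->
  forall f : nat -> vec, ONB_sN n f ->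
    exists c : R, c < 0 /\
      nontrivial_solvsoliton_with_const (sbr n) (ip (sdim n)) f (2 * n + 1) c.
Proof.
intros [|m] Hn f Hf; [lia|].
exists (- ricci_const m). split; [pose proof (ricci_const_pos m); lra|].
split; [|split].
- now apply sbr_solvable.
- exists (ricci_der m). split; [now apply ricci_der_derivation|now apply ric_op_soliton].
- apply sbr_not_einstein; [assumption|lia].
Qed.
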